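(* Let $\mu(t)=(\mu^{1,c}(t),\mu^{1,p}(t),\ldots,\mu^{r,c}(t),\mu^{r,p}(t))$ be the solution of the McKean-Vlasov system $$\dot\mu^{j,\iota}(t)=\mu^{j,\iota}(t)A^{j,\iota}_{\mu(t)},\qquad 1\le j\le r,\ \iota\in\{c,p\},$$ starting at some $\mu(0)\in(\mathcal{M}_1(\mathcal{Z}))^{2r}$. Then, for all $t>0$, $$\frac{d}{dt}F(\mu(t))=\frac{d}{dt}\sum_{j=1}^r\Big(\alpha_jp_j^cR\big(\mu^{j,c}(t)\|\pi^{j,c}(\nu)\big)+\alpha_jp_j^pR\big(\mu^{j,p}(t)\|\pi^{j,p}(\nu)\big)\Big)\Big|_{\nu=\mu(t)}\le0,$$ where the time derivative in the middle expression is taken with $\nu\in(\mathcal{M}_1(\mathcal{Z}))^{2r}$ held fixed, and $\nu$ is then set equal to $\mu(t)$. Moreover, $\frac{d}{dt}F(\mu(t))=0$ if and only if $\mu^{j,\iota}(t)=\pi^{j,\iota}(\mu(t))$ for all $\iota\in\{c,p\}$ and $1\le j\le r$.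
   Context: $\mathcal{Z}=\{1,\ldots,K\}$ is a finite set and $\mathcal{M}_1(\mathcal{Z})$ is the set of probability measures on $\mathcal{Z}$ (row vectors in $\mathbb{R}^K$). Parameters: $r$ is a positive integer; $\alpha_j,p_j^c,p_j^p\in(0,1)$ for $1\le j\le r$ with $p_j^c+p_j^p=1$ and $\sum_j\alpha_j=1$; $\beta>0$; $W:\mathcal{Z}\times\mathcal{Z}\to\mathbb{R}$ is symmetric. $\mathcal{E}\subset\mathcal{Z}\times\mathcal{Z}\setminus\{(z,z):z\in\mathcal{Z}\}$ is symmetric with $(\mathcal{Z},\mathcal{E})$ irreducible, and $a(z,z')=1$ if $(z,z')\in\mathcal{E}$, $a(z,z')=0$ otherwise. **Rate matrices.** For $q=(q^{1,c},q^{1,p},\ldots,q^{r,c},q^{r,p})\in(\mathcal{M}_1(\mathcal{Z}))^{2r}$ let $$\psi^{j,c}(z,z',q)=\beta\sum_{x\in\mathcal{Z}}(W(x,z')-W(x,z))\big(\alpha_jp_j^cq_x^{j,c}+\alpha_jp_j^pq_x^{j,p}\big),$$ $$\psi^{j,p}(z,z',q)=\beta\sum_{x\in\mathcal{Z}}(W(x,z')-W(x,z))\Big(\alpha_jp_j^cq_x^{j,c}+\sum_{l=1}^r\alpha_lp_l^pq_x^{l,p}\Big),$$ and for $\iota\in\{c,p\}$ let $\lambda^{j,\iota}_{z,z'}(q)=e^{-(\psi^{j,\iota}(z,z',q))^+}a(z,z')$ for $z\ne z'$, $\lambda^{j,\iota}_{z,z}(q)=-\sum_{z'\ne z}\lambda^{j,\iota}_{z,z'}(q)$,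 $A^{j,\iota}_q=(\lambda^{j,\iota}_{z,z'}(q))_{z,z'\in\mathcal{Z}}$. Here $u^+=\max(u,0)$. **The measures $\pi^{j,\iota}(q)$.** For $q\in(\mathcal{M}_1(\mathcal{Z}))^{2r}$, $\pi^{j,c}(q)$ and $\pi^{j,p}(q)$ are the probability measures on $\mathcal{Z}$ given, up to normalization in $z$, by $$\pi^{j,c}(q)_z\propto\exp\Big\{-\beta\Big[\alpha_jp_j^c\sum_{x\in\mathcal{Z}}W(x,z)q_x^{j,c}+\alpha_jp_j^p\sum_{x\in\mathcal{Z}}W(x,z)q_x^{j,p}\Big]\Big\},$$ $$\pi^{j,p}(q)_z\propto\exp\Big\{-\beta\Big[\alpha_jp_j^c\sum_{x\in\mathcal{Z}}W(x,z)q_x^{j,c}+\sum_{l=1}^r\alpha_lp_l^p\sum_{x\in\mathcal{Z}}W(x,z)q_x^{l,p}\Big]\Big\}.$$ **Relative entropy.** $R(p\|p')=\sum_{z\in\mathcal{Z}}p_z\log(p_z/p'_z)$, with $0\log0=0$. **The function $F$.** With $C\in\mathbb{R}$ a constant not depending on $q$, $$\begin{aligned}F(q)=&\sum_{j=1}^r\frac{\beta}{2}\bigg\{(\alpha_jp_j^c)^2\sum_{z,z'\in\mathcal{Z}}W(z,z')q_{z'}^{j,c}q_z^{j,c}+2\alpha_j^2p_j^pp_j^c\sum_{z,z'\in\mathcal{Z}}W(z,z')q_{z'}^{j,p}q_z^{j,c}\\&\qquad+\alpha_jp_j^p\sum_{k=1}^r\alpha_kp_k^p\sum_{z,z'\in\mathcal{Z}}W(z,z')q_{z'}^{k,p}q_z^{j,p}\bigg\}\\&+\sum_{j=1}^r\Big(\alpha_jp_j^c\sum_{z\in\mathcal{Z}}q_z^{j,c}\log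 q_z^{j,c}+\alpha_jp_j^p\sum_{z\in\mathcal{Z}}q_z^{j,p}\log q_z^{j,p}\Big)+C.\end{aligned}$$ *)

(* Defs.v *)
From HB Require Import structures.
From mathcomp Require Import all_boot all_order all_algebra.
From mathcomp Require Import all_classical all_reals all_analysis.
Import Order.TTheory GRing.Theory Num.Theory.
Import numFieldNormedType.Exports.

Set Implicit Arguments.
Unset Strict Implicit.
Unset Printing Implicit Defensive.

Local Open Scope classical_set_scope.
Local Open Scope ring_scope.

Inductive role := central | peripheral.

(* Data only: the standing assumptions are hypotheses of the theorem. The state
   space {1, ..., K} is 'I_K, and [prop j i] is p_j^i. *)
Record params (R : realType) (r K : nat) := Params {
  alpha : 'I_r -> R;
  prop : 'I_r -> role -> R;
  beta : R;
  W : 'I_K -> 'I_K -> R;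
  edge : rel 'I_K
}.

Definition state (R : realType) (r K : nat) := 'I_r -> role -> 'rV[R]_K.

Definition is_prob (R : realType) (K : nat) (u : 'rV[R]_K) : Prop :=
  (forall z, 0 <= u 0 z) /\ \sum_z u 0 z = 1.

Definition psi (R : realType) (r K : nat) (m : params R r K)
    (j : 'I_r) (i : role) (z z' : 'I_K) (q : state R r K) : R :=
  match i with
  | central =>
      beta m * \sum_x (W m x z' - W m x z) *
        (alpha m j * prop m j central * q j central 0 x
         + alpha m j * prop m j peripheral * q j peripheral 0 x)
  | peripheral =>
      beta m * \sum_x (W m x z' - W m x z) *
        (alpha m j * prop m j central * q j central 0 x
         + \sum_l alpha m l * prop m l peripheral * q l peripheral 0 x)
  end.

Definition jump_rate (R : realType) (r K : nat) (m : params R r K)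
    (j : 'I_r) (i : role) (q : state R r K) (z z' : 'I_K) : R :=
  expR (- Num.max (psi m j i z z' q) 0) * (edge m z z')%:R.

Definition rate_mx (R : realType) (r K : nat) (m : params R r K)
    (j : 'I_r) (i : role) (q : state R r K) : 'M[R]_K :=
  \matrix_(z, z')
    if z == z' then - \sum_(y | y != z) jump_rate m j i q z y
    else jump_rate m j i q z z'.

Definition gibbs_weight (R : realType) (r K : nat) (m : params R r K)
    (j : 'I_r) (i : role) (q : state R r K) (z : 'I_K) : R :=
  match i with
  | central =>
      expR (- beta m *
        (alpha m j * prop m j central * (\sum_x W m x z * q j central 0 x)
         + alpha m j * prop m j peripheral
             * (\sum_x W m x z * q j peripheral 0 x)))
  | peripheral =>
      expR (- beta m *
        (alpha m j * prop m j central * (\sum_x W m x z * q j central 0 x)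
         + \sum_l alpha m l * prop m l peripheral
             * (\sum_x W m x z * q l peripheral 0 x)))
  end.

Definition gibbs (R : realType) (r K : nat) (m : params R r K)
    (j : 'I_r) (i : role) (q : state R r K) : 'rV[R]_K :=
  \row_z (gibbs_weight m j i q z / \sum_y gibbs_weight m j i q y).

(* The convention 0 log 0 = 0 holds because the first factor vanishes. Where
   v vanishes and u does not, this is not the usual +oo, but v is only ever a
   [gibbs] measure below, whose entries are positive. *)
Definition rel_entropy (R : realType) (K : nat) (u v : 'rV[R]_K) : R :=
  \sum_z u 0 z * ln (u 0 z / v 0 z).

Definition free_energy (R : realType) (r K : nat) (m : params R r K) (C : R)
    (q : state R r K) : R :=
  \sum_j beta m / 2 *
    ((alpha m j * prop m j central) ^+ 2
       * (\sum_z \sum_z' W m z z' * q j central 0 z' * q j central 0 z)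
     + 2 * alpha m j ^+ 2 * prop m j peripheral * prop m j central
       * (\sum_z \sum_z' W m z z' * q j peripheral 0 z' * q j central 0 z)
     + alpha m j * prop m j peripheral
       * (\sum_k alpha m k * prop m k peripheral
            * (\sum_z \sum_z'
                 W m z z' * q k peripheral 0 z' * q j peripheral 0 z)))
  + \sum_j
      (alpha m j * prop m j central
         * (\sum_z q j central 0 z * ln (q j central 0 z))
       + alpha m j * prop m j peripheral
         * (\sum_z q j peripheral 0 z * ln (q j peripheral 0 z)))
  + C.

Definition total_rel_entropy (R : realType) (r K : nat) (m : params R r K)
    (q nu : state R r K) : R :=
  \sum_j
    (alpha m j * prop m j central
       * rel_entropy (q j central) (gibbs m j central nu)
     + alpha m j * prop m j peripheral
       * rel_entropy (q j peripheral) (gibbs m j peripheral nu)).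

(* Only the values mu t with t >= 0 matter. That mu t stays in the product of
   simplices for t > 0 is not required: the formulas for the rates make sense
   on all of R^K, and invariance is a consequence. *)
Definition McKean_Vlasov_solution (R : realType) (r K : nat)
    (m : params R r K) (mu : R -> state R r K) : Prop :=
  forall j i,
    [/\ is_prob (mu 0 j i),
        (fun s => mu s j i) @ 0^'+ --> mu 0 j i &
        forall t : R, 0 < t ->
          is_derive t 1 (fun s => mu s j i)
            (mu t j i *m rate_mx m j i (mu t))].

(* Main.v *)
(* Along the flow, each component u of mu solves a linear master equation
   u'_z = \sum_y (u_y lam_yz - u_z lam_zy) with rates in [0, 1], whatever the
   other components do. A Gronwall estimate for \sum_z min(u_z, 0)^2 gives
   u >= 0, and for t > 0 an entry cannot vanish: it would be at a minimum, so
   its inflow would vanish and, by connectedness, the whole vector would be 0.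
   Positivity makes F and R differentiable in time. Since u' has zero mass and
   -ln pi is, up to an additive constant, the gradient of the interaction
   energy, both derivatives equal
     \sum_(j, i) alpha_j p_j^i \sum_z u'_z ln (u_z / pi_z).
   With lam frozen at time t, pi satisfies detailed balance; with h = u / pi the
   inner sum is
     - 1/2 \sum_(z, y) pi_y lam_yz (h_y - h_z) (ln h_y - ln h_z) <= 0,
   which vanishes iff h is constant on the connected graph, i.e. u = pi. *)
Require Import Defs.
From HB Require Import structures.
From mathcomp Require Import all_boot all_order all_algebra.
From mathcomp Require Import all_classical all_reals all_analysis.
From mathcomp Require Import ring lra.
Import Order.TTheory GRing.Theory Num.Theory.
Import numFieldNormedType.Exports.
Set Implicit Arguments.
Unset Strict Implicit.
Unset Printing Implicit Defensive.
Local Open Scope classical_set_scope.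
Local Open Scope ring_scope.

(** * Differentiation rules and a one-sided Gronwall estimate *)

Lemma is_derive_fsum (R : realType) n (h : 'I_n -> R -> R) (dh : 'I_n -> R)
    (x v : R) : (forall i, is_derive x v (h i) (dh i)) ->
  is_derive x v (fun s => \sum_i h i s) (\sum_i dh i).
Proof.
move=> dh_; have := is_derive_sum dh_.
by congr is_derive; apply/funext => s; rewrite fct_sumE.
Qed.

Lemma is_derive_coord (R : realType) p q (M : R -> 'M[R]_(p, q)) dM
    (x v : R) i j :
  is_derive x v M dM -> is_derive x v (fun s => M s i j) (dM i j).
Proof.
move=> [dM_ <-]; apply: DeriveDef; first exact: (derivable_mxP _ _ _).1.
by rewrite derive_mx// mxE.
Qed.

Lemma is_derive_cstM (R : realType) (a t : R) (f : R -> R) (df : R) :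
  is_derive t 1 f df -> is_derive t 1 (fun s => a * f s) (a * df).
Proof.
move=> fdf; apply: (is_derive_eq (is_deriveM (is_derive_cst a _ _) fdf)).
by rewrite /GRing.scale/= mulr0 addr0.
Qed.

(** The function [expR (- c * s) * f s] has nonpositive derivative for [s > 0], hence is
    nonincreasing on the closed half-line. The solution is differentiable only at positive times, so
    right continuity at 0 has to carry the initial value. *)
Lemma gronwall_le0 (R : realType) (c t : R) (f df : R -> R) : 0 <= t ->
  f 0 <= 0 -> f @ 0^'+ --> f 0 ->
  (forall s : R, 0 < s -> is_derive s 1 f (df s)) ->
  (forall s : R, 0 < s -> df s <= c * f s) -> f t <= 0.
Proof.
move=> t0 f0 cf fdf dfle.
pose g := fun s : R => expR (- c * s) * f s.
have dE (s : R) :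
    is_derive s 1 (fun s : R => expR (- c * s)) (expR (- c * s) * - c).
  have d1 : is_derive s 1 (fun s : R => - c * s) (- c).
    by apply: is_derive_eq; rewrite /GRing.scale/=; ring.
  exact: (is_derive1_comp (g := fun s : R => - c * s)).
have dg (s : R) : 0 < s -> is_derive s 1 g (expR (- c * s) * (df s - c * f s)).
  move=> s0; have := is_deriveM (dE s) (fdf s s0).
  move=> H; apply: (is_derive_eq H); rewrite /GRing.scale/=; ring.
suff : g t <= g 0.
  rewrite /g mulr0 expR0 mul1r => /le_trans/(_ f0).
  by rewrite pmulr_rle0// expR_gt0.
apply: (@ler0_derive1_nincry _ g 0) => //.
- by move=> s; rewrite in_itv/= andbT => /dg[].
- move=> s; rewrite in_itv/= andbT => s0; have [_ dgE] := dg s s0.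
  by rewrite derive1E dgE pmulr_rle0 ?expR_gt0// subr_le0 dfle.
- apply: derivable_oy_Rcontinuous_within_itvcy; split.
    by move=> s; rewrite in_itv/= andbT => /dg[].
  apply: cvgM => //; apply: cvg_at_right_filter.
  have [/derivable1_diffP/differentiable_continuous d0 _] := dE 0; exact: d0.
Qed.

(** Squaring removes the kink of the negative part at 0, so that the Gronwall estimate applies to a
    sum of such squares. *)
Lemma is_derive_min0_sq (R : realType) (x : R) :
  is_derive x 1 (fun y : R => Num.min y 0 ^+ 2) (2 * Num.min x 0).
Proof.
have [x0|x0|->] := ltgtP x 0.
- apply: (near_eq_is_derive (f := fun y : R => y ^+ 2)).
    by near=> y; rewrite min_l// ltW//; near: y; exact: lt_nbhsl.
  by apply: is_derive_eq; rewrite /GRing.scale/=; ring.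
- apply: (near_eq_is_derive (f := cst 0)).
    by near=> y; rewrite min_r ?expr0n// ltW//; near: y; exact: lt_nbhsr.
  by apply: is_derive_eq; rewrite mulr0.
- have H : (fun h : R => h^-1 *: (Num.min (h *: (1 : R) + 0) 0 ^+ 2
      - Num.min (0 : R) 0 ^+ 2)) @ 0^' --> (0 : R).
    (* At 0 the difference quotient is [Num.min h 0] itself, which tends to 0. *)
    rewrite [X in X @ _](_ : _ = fun h : R => Num.min h 0); last first.
      apply/funext => h; rewrite /GRing.scale/= mulr1 addr0 minxx expr0n subr0.
      have [h0|h0] := ltP h 0; first by rewrite expr2 mulKf// lt_eqF.
      by rewrite expr0n mulr0.
    have : {for (0 : R), continuous ((id : R -> R) \min cst (0 : R))}.
      by apply: continuous_min; [exact: cvg_id|exact: cvg_cst].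
    by move=> /cvg_within_filter/(_ _ _); rewrite /= minxx; apply.
  rewrite mulr0; apply: DeriveDef; last exact/cvg_lim.
  by apply/cvg_ex; exists 0.
Unshelve. all: by end_near. Qed.

(** * Linear master equations with time-dependent rates: mass, sign, strict positivity *)

Definition net_inflow (R : realType) n (lam : 'I_n -> 'I_n -> R)
    (u : 'I_n -> R) (z : 'I_n) : R :=
  \sum_y (u y * lam y z - u z * lam z y).

(** Summation by parts: the flux between [y] and [z] is antisymmetric, so symmetrizing the double
    sum replaces [f z] by half a difference. Constant [f] gives conservation of mass; a logarithm
    gives the entropy production. *)
Lemma sum_net_inflowM (R : realType) n (lam : 'I_n -> 'I_n -> R)
    (u f : 'I_n -> R) :
  \sum_z net_inflow lam u z * f z
  = - (\sum_z \sum_y (u y * lam y z - u z * lam z y) * (f y - f z)) / 2.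
Proof.
pose G z y := (u y * lam y z - u z * lam z y) * f z.
have -> : \sum_z net_inflow lam u z * f z = \sum_z \sum_y G z y.
  by apply: eq_bigr => z _; rewrite mulr_suml.
have -> : \sum_z \sum_y (u y * lam y z - u z * lam z y) * (f y - f z)
    = \sum_z \sum_y - G y z - \sum_z \sum_y G z y.
  rewrite -sumrB; apply: eq_bigr => z _; rewrite -sumrB.
  by apply: eq_bigr => y _; rewrite /G; ring.
have -> : \sum_z \sum_y - G y z = - \sum_z \sum_y G z y.
  rewrite exchange_big/= -sumrN; apply: eq_bigr => z _; exact: sumrN.
by field.
Qed.

Lemma sum_net_inflow (R : realType) n (lam : 'I_n -> 'I_n -> R)
    (u : 'I_n -> R) : \sum_z net_inflow lam u z = 0.
Proof.
transitivity (\sum_z net_inflow lam u z * 1).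
  by apply: eq_bigr => z _; rewrite mulr1.
rewrite (sum_net_inflowM lam u (fun=> 1)) big1 ?oppr0 ?mul0r// => z _.
by rewrite big1// => y _; rewrite subrr mulr0.
Qed.

Section master_equation.
Context {R : realType} (n : nat).
Variables (u : R -> 'I_n -> R) (lam : R -> 'I_n -> 'I_n -> R).
Hypothesis u_cvg0 : forall z, u s z @[s --> (0 : R)^'+] --> u 0 z.
Hypothesis u_deriv : forall (t : R) z, 0 < t ->
  is_derive t 1 (fun s => u s z) (net_inflow (lam t) (u t) z).

Lemma master_mass t : 0 <= t -> \sum_z u t z = \sum_z u 0 z.
Proof.
move=> t0.
pose S s := \sum_z u s z.
have cvS : S @ 0^'+ --> S 0.
  by apply: cvg_big => [|z _]; [exact: add_continuous|exact: u_cvg0].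
have dS (s : R) : 0 < s -> is_derive s 1 S 0.
  move=> s0; apply: (is_derive_eq _ (sum_net_inflow (lam s) (u s))).
  by apply: is_derive_fsum => z; exact: u_deriv.
(* The Gronwall estimate is one-sided; a free factor [k], taken as 1 and as -1, gives both
   inequalities. *)
have S_le (k : R) : k * (S t - S 0) <= 0.
  apply: (@gronwall_le0 _ 0 t (fun s => k * (S s - S 0)) (fun=> k * 0)) => //.
  - by rewrite subrr mulr0.
  - by apply: cvgMl_tmp; apply: cvgB => //; exact: cvg_cst.
  - move=> s s0; apply: is_derive_cstM.
    apply: (is_derive_eq (is_deriveB (dS s s0) (is_derive_cst (S 0) _ _))).
    by rewrite subr0.
  - by move=> s _; rewrite mulr0 mul0r.
apply/eqP; rewrite -/(S t) -/(S 0) eq_le -[X in X && _]subr_le0.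
by rewrite -[S t - _]mul1r S_le -subr_le0 -opprB -mulN1r S_le.
Qed.

Hypothesis lam_ge0 : forall t y z, 0 <= lam t y z.

(** [N] measures the negative parts. It vanishes at time 0 and its derivative is at most
    [2 * L * n%:R * N], so it stays 0. *)
Lemma master_ge0 L t z : 0 <= L -> (forall s y z, lam s y z <= L) ->
  (forall z, 0 <= u 0 z) -> 0 <= t -> 0 <= u t z.
Proof.
move=> L0 lamL u0 t0.
pose m s z := Num.min (u s z) 0.
pose N s := \sum_z m s z ^+ 2.
have N0 s : 0 <= N s by apply: sumr_ge0 => y _; exact: sqr_ge0.
have m0 s y : m s y <= 0 by rewrite ge_min lexx orbT.
have mu s y : m s y <= u s y by rewrite ge_min lexx.
have mum s y : m s y * u s y = m s y ^+ 2.
  by rewrite /m; have [h|h] := ltP (u s y) 0; rewrite ?mul0r// expr0n.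
suff Nt : N t <= 0.
  have : N t == 0 by rewrite eq_le Nt N0.
  rewrite psumr_eq0 => [/allP/(_ z (mem_index_enum _))/=|? _]; last first.
    exact: sqr_ge0.
  by rewrite sqrf_eq0 => /eqP mz; rewrite -mz.
apply: (@gronwall_le0 _ (2 * L * n%:R) t N
  (fun s => \sum_z 2 * m s z * net_inflow (lam s) (u s) z)) => //.
- by rewrite /N big1// => y _; rewrite /m min_r ?expr0n.
- apply: cvg_big => [|y _]; first exact: add_continuous.
  have := is_derive_min0_sq (u 0 y).
  move=> [/derivable1_diffP/differentiable_continuous d0 _].
  exact: (continuous_cvg _ d0 (@u_cvg0 y)).
- move=> s s0; apply: is_derive_fsum => y.
  exact: (is_derive1_comp (is_derive_min0_sq _) (u_deriv y s0)).
- move=> s s0.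
  (* The constant is chosen so that the bound splits over ordered pairs, each of the two squares
     summing to [n%:R * N s]. The inequality is then proved pair by pair. *)
  have -> : 2 * L * n%:R * N s = \sum_z \sum_y L * (m s z ^+ 2 + m s y ^+ 2).
    have E : \sum_(z < n) \sum_(y < n) m s z ^+ 2 = n%:R * N s.
      rewrite /N mulr_sumr; apply: eq_bigr => y _.
      by rewrite sumr_const card_ord mulr_natl.
    under eq_bigr do rewrite -mulr_sumr big_split/=.
    rewrite -mulr_sumr big_split/= E exchange_big/= E; ring.
  apply: ler_sum => y _; rewrite /net_inflow mulr_sumr; apply: ler_sum => x _.
  have := mum s y; have := m0 s y; have := m0 s x; have := mu s x.
  have := lam_ge0 s x y; have := lam_ge0 s y x; have := lamL s x y.
  move: (lam s x y) (lam s y x) (m s x) (m s y) (u s x) (u s y).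
  move=> a b mx my ux uy aL b0 a0 mx_le mx0 my0 E.
  (* The inflow satisfies [2 * my * ux * a <= 2 * my * mx * L <= L * (mx ^+ 2 + my ^+ 2)], and the
     outflow contributes [- 2 * my ^+ 2 * b <= 0]. *)
  have h1 : my * (ux * a) <= my * (mx * a) by rewrite ler_wnM2l// ler_wpM2r.
  have h2 : 0 <= my * uy * b by rewrite E mulr_ge0// sqr_ge0.
  have h3 : my * mx * a <= my * mx * L by rewrite ler_wpM2l// mulr_le0.
  have h4 : 0 <= (mx - my) ^+ 2 * L by rewrite mulr_ge0// sqr_ge0.
  move: h1 h2 h3 h4; rewrite !expr2; nra.
Qed.

Lemma master_gt0 (e : rel 'I_n) t z :
  (forall s z, 0 <= s -> 0 <= u s z) -> 0 < \sum_z u 0 z ->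
  (forall s y z, e y z -> 0 < lam s y z) -> (forall y z, connect e y z) ->
  0 < t -> 0 < u t z.
Proof.
move=> u0 mass lam_gt0 conn t0.
rewrite lt0r (u0 _ _ (ltW t0)) andbT; apply/eqP => utz.
have step y x : e y x -> u t x = 0 -> u t y = 0.
  move=> eyx utx.
  (* Any interval of positive times around [t] would do; it makes the zero of [u] an interior
     minimum, where the derivative vanishes. *)
  have t2 : t \in `]0, (2 * t)[ by rewrite in_itv/= t0/=; lra.
  have [_ D0] : is_derive t 1 (fun s => u s x) 0.
    apply: (@derive1_at_min _ _ 0 (2 * t)) => //; first by lra.
    + by move=> s; rewrite in_itv/= => /andP[s0 _]; case: (u_deriv x s0).
    + by move=> s; rewrite in_itv/= => /andP[s0 _]; rewrite utx u0// ltW.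
  have [_] := u_deriv x t0; rewrite D0 /net_inflow utx => /esym/eqP.
  under eq_bigr do rewrite mul0r subr0.
  rewrite psumr_eq0 => [/allP/(_ y (mem_index_enum _))/=|w _]; last first.
    by rewrite mulr_ge0// u0// ltW.
  by rewrite mulf_eq0 [X in _ || X]gt_eqF ?lam_gt0// orbF => /eqP.
(* Zeros spread against the edges, from the head of an edge to its tail, so the induction runs along
   a path ending at [z]. *)
have all0 y : u t y = 0.
  have /connectP[p] := conn y z.
  elim: p y => [y _ /= <-//|x p IH y /= /andP[eyx px] zE].
  exact/(step y x eyx)/IH.
by move: mass; rewrite -(master_mass (ltW t0)) big1 ?ltxx.
Qed.

End master_equation.

(** * Entropy production under detailed balance *)

Lemma mulrB_lnB_ge0 (R : realType) (a b : R) : 0 < a -> 0 < b ->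
  0 <= (a - b) * (ln a - ln b).
Proof.
move=> a0 b0; have [ab|/ltW ba] := leP a b.
  by rewrite mulr_le0 ?subr_le0 ?ler_ln.
by rewrite mulr_ge0 ?subr_ge0 ?ler_ln.
Qed.

Lemma mulrB_lnB_eq0 (R : realType) (a b : R) : 0 < a -> 0 < b ->
  (a - b) * (ln a - ln b) = 0 -> a = b.
Proof.
move=> a0 b0 /eqP; rewrite mulf_eq0 !subr_eq0 => /orP[/eqP//|/eqP].
exact: ln_inj.
Qed.

Section entropy_production.
Context {R : realType} (n : nat).
Variables (lam : 'I_n -> 'I_n -> R) (q p : 'I_n -> R).
Hypothesis lam_ge0 : forall y z, 0 <= lam y z.
Hypothesis q_gt0 : forall z, 0 < q z.
Hypothesis p_gt0 : forall z, 0 < p z.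
Hypothesis detailed_balance : forall y z, p y * lam y z = p z * lam z y.

Let h z := q z / p z.
Let h_gt0 z : 0 < h z. Proof. exact: divr_gt0. Qed.

(** By detailed balance both halves of the flux carry the same factor [p y * lam y z], so the flux
    is that factor times [h y - h z]. Each term then pairs two increments of equal sign. *)
Let entropy_productionE :
  \sum_z net_inflow lam q z * ln (q z / p z)
  = - (\sum_z \sum_y p y * lam y z * ((h y - h z) * (ln (h y) - ln (h z)))) / 2.
Proof.
rewrite sum_net_inflowM; congr (- _ / _).
apply: eq_bigr => z _; apply: eq_bigr => y _.
rewrite mulrA; congr (_ * _).
have -> : q y * lam y z = p y * lam y z * h y.
  by rewrite /h; field; rewrite gt_eqF.
have -> : q z * lam z y = p y * lam y z * h z.
  rewrite detailed_balance.
  by rewrite /h; field; rewrite gt_eqF.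
by rewrite mulrBr.
Qed.

Let term_ge0 z y :
  0 <= p y * lam y z * ((h y - h z) * (ln (h y) - ln (h z))).
Proof.
by apply: mulr_ge0; [apply: mulr_ge0 => //; exact: ltW|exact: mulrB_lnB_ge0].
Qed.

Lemma entropy_production_le0 :
  \sum_z net_inflow lam q z * ln (q z / p z) <= 0.
Proof.
rewrite entropy_productionE mulNr oppr_le0 divr_ge0//.
by apply: sumr_ge0 => z _; apply: sumr_ge0 => y _; exact: term_ge0.
Qed.

Lemma entropy_production_eq0 (e : rel 'I_n) :
  (forall y z, e y z -> 0 < lam y z) -> (forall y z, connect e y z) ->
  \sum_z q z = 1 -> \sum_z p z = 1 ->
  \sum_z net_inflow lam q z * ln (q z / p z) = 0 <-> q =1 p.
Proof.
move=> lam_gt0 conn q1 p1; split; last first.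
  by move=> qp; rewrite big1// => z _; rewrite qp divff ?gt_eqF// ln1 mulr0.
rewrite entropy_productionE => /eqP.
rewrite mulf_eq0 oppr_eq0 invr_eq0 pnatr_eq0 orbF psumr_eq0; last first.
  by move=> z _; apply: sumr_ge0 => y _; exact: term_ge0.
move=> /allP H.
have step y z : e y z -> h y = h z.
  move=> eyz; have := H z (mem_index_enum _).
  rewrite /= psumr_eq0 => [|? _]; last exact: term_ge0.
  move=> /allP/(_ y (mem_index_enum _))/=.
  rewrite mulf_eq0 gt_eqF ?mulr_gt0// ?lam_gt0//= => /eqP.
  exact: mulrB_lnB_eq0.
have hcst y z : h y = h z.
  have /connectP[s] := conn y z.
  by elim: s y => [y _ -> //|x s IH y /= /andP[/step -> xs] zE]; exact: IH.
move=> z.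
(* Here [q] is a constant multiple of [p], and both have mass 1. *)
have hz1 : h z = 1.
  rewrite -q1 -[LHS]mulr1 -p1 mulr_sumr; apply: eq_bigr => y _.
  by rewrite (hcst z y) /h divfK// gt_eqF.
by rewrite -[LHS](@divfK _ (p z)) ?gt_eqF// -/(h z) hz1 mul1r.
Qed.

End entropy_production.

(** * Time derivatives of entropies and of interaction energies *)

Lemma is_derive_xln (R : realType) (q : R -> R) (dq t : R) :
  0 < q t -> is_derive t 1 q dq ->
  is_derive t 1 (fun s => q s * ln (q s)) (dq * ln (q t) + dq).
Proof.
move=> q0 dqt.
have dl := is_derive1_comp (is_derive1_ln q0) dqt.
apply: (is_derive_eq (is_deriveM dqt dl)); rewrite /GRing.scale/=.
by field; rewrite gt_eqF.
Qed.

(** The derivative of [x * ln x] is [ln x + 1]; the contributions of the 1 add up to the total mass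
    of [dq], which is zero. *)
Lemma is_derive_entropy (R : realType) n (q : R -> 'I_n -> R) (dq : 'I_n -> R)
    (t : R) : (forall z, 0 < q t z) ->
  (forall z, is_derive t 1 (fun s => q s z) (dq z)) -> \sum_z dq z = 0 ->
  is_derive t 1 (fun s => \sum_z q s z * ln (q s z)) (\sum_z dq z * ln (q t z)).
Proof.
move=> q0 dqt dq0.
apply: (is_derive_eq (is_derive_fsum (fun z => is_derive_xln (q0 z) (dqt z)))).
by rewrite big_split/= dq0 addr0.
Qed.

Lemma is_derive_rel_entropy (R : realType) n (q : R -> 'rV[R]_n) (v : 'rV[R]_n)
    (dq : 'I_n -> R) (t : R) :
  (forall z, 0 < q t 0 z) -> (forall z, 0 < v 0 z) ->
  (forall z, is_derive t 1 (fun s => q s 0 z) (dq z)) -> \sum_z dq z = 0 ->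
  is_derive t 1 (fun s => rel_entropy (q s) v)
    (\sum_z dq z * ln (q t 0 z / v 0 z)).
Proof.
move=> q0 v0 dqt dq0.
have dl z : is_derive t 1 (fun s => q s 0 z * ln (q s 0 z / v 0 z))
    (dq z * ln (q t 0 z / v 0 z) + dq z).
  have dv : is_derive t 1 (fun s => q s 0 z / v 0 z) (dq z / v 0 z).
    apply: (is_derive_eq (is_deriveM (dqt z) (is_derive_cst (v 0 z)^-1 _ _))).
    by rewrite /GRing.scale/= mulr0 add0r mulrC.
  have d := is_derive1_comp (g := fun s => q s 0 z / v 0 z)
    (is_derive1_ln (divr_gt0 (q0 z) (v0 z))) dv.
  apply: (is_derive_eq (is_deriveM (dqt z) d)); rewrite /GRing.scale/=.
  by field; rewrite !gt_eqF// divr_gt0.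
apply: (is_derive_eq (is_derive_fsum dl)).
by rewrite big_split/= dq0 addr0.
Qed.

Definition interaction (R : realType) n (w : 'I_n -> 'I_n -> R)
    (u v : 'I_n -> R) : R := \sum_z \sum_z' w z z' * u z' * v z.

Lemma interactionC (R : realType) n (w : 'I_n -> 'I_n -> R) u v :
  (forall z z', w z z' = w z' z) -> interaction w u v = interaction w v u.
Proof.
move=> wC; rewrite /interaction exchange_big/=.
by apply: eq_bigr => z _; apply: eq_bigr => y _; rewrite wC mulrAC.
Qed.

Lemma is_derive_interaction (R : realType) n (w : 'I_n -> 'I_n -> R)
    (u v : R -> 'I_n -> R) du dv (t : R) :
  (forall z, is_derive t 1 (fun s => u s z) (du z)) ->
  (forall z, is_derive t 1 (fun s => v s z) (dv z)) ->
  is_derive t 1 (fun s => interaction w (u s) (v s))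
    (interaction w du (v t) + interaction w (u t) dv).
Proof.
move=> dut dvt.
have d z z' : is_derive t 1 (fun s => w z z' * u s z' * v s z)
    (w z z' * du z' * v t z + w z z' * u t z' * dv z).
  have dw := is_derive_cstM (w z z') (dut z').
  apply: (is_derive_eq (is_deriveM dw (dvt z))); rewrite /GRing.scale/=; ring.
apply: (is_derive_eq (is_derive_fsum (fun z => is_derive_fsum (d z)))).
by rewrite -big_split/=; apply: eq_bigr => z _; rewrite big_split.
Qed.

(** * The model: potentials, Gibbs measures, rates, and derivatives of both functionals *)

Section model.
Context {R : realType} (r K : nat) (m : params R r K).

Let c j i := alpha m j * prop m j i.

Definition load (j : 'I_r) (i : role) (q : state R r K) (x : 'I_K) : R :=
  c j central * q j central 0 x +
  match i with
  | central => c j peripheral * q j peripheral 0 x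
  | peripheral => \sum_l c l peripheral * q l peripheral 0 x
  end.

(** The rates depend on increments of this function and the Gibbs weights are its Boltzmann factors,
    which is the source of detailed balance. *)
Definition potential (j : 'I_r) (i : role) (q : state R r K) (z : 'I_K) : R :=
  beta m * \sum_x W m x z * load j i q x.

Lemma psiE j i z z' q :
  psi m j i z z' q = potential j i q z' - potential j i q z.
Proof.
transitivity (beta m * \sum_x (W m x z' - W m x z) * load j i q x).
  by case: i.
rewrite /potential -mulrBr; congr (_ * _); rewrite -sumrB.
by apply: eq_bigr => x _; rewrite mulrBl.
Qed.

Lemma gibbs_weightE j i q z :
  gibbs_weight m j i q z = expR (- potential j i q z).
Proof.
rewrite /gibbs_weight /potential /load.
case: i; congr expR; rewrite mulNr; congr (- (_ * _)).
- rewrite !mulr_sumr -big_split/=; apply: eq_bigr => x _; rewrite /c; ring.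
- under [RHS]eq_bigr do rewrite mulrDr.
  rewrite big_split/=; congr (_ + _).
    rewrite mulr_sumr; apply: eq_bigr => x _; rewrite /c; ring.
  under [RHS]eq_bigr do rewrite mulr_sumr.
  rewrite exchange_big/=; apply: eq_bigr => l _.
  rewrite mulr_sumr; apply: eq_bigr => x _; rewrite /c; ring.
Qed.

Lemma gibbs_weight_gt0 j i q z : 0 < gibbs_weight m j i q z.
Proof. by rewrite gibbs_weightE expR_gt0. Qed.

Lemma sum_gibbs_weight_gt0 j i q (z : 'I_K) : 0 < \sum_y gibbs_weight m j i q y.
Proof.
rewrite (bigD1 z)//= ltr_wpDr ?gibbs_weight_gt0//.
by apply: sumr_ge0 => y _; exact/ltW/gibbs_weight_gt0.
Qed.

Lemma gibbs_gt0 j i q z : 0 < gibbs m j i q 0 z.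
Proof.
by rewrite mxE divr_gt0 ?gibbs_weight_gt0 ?sum_gibbs_weight_gt0.
Qed.

Lemma sum_gibbs j i q (z : 'I_K) : \sum_y gibbs m j i q 0 y = 1.
Proof.
under eq_bigr do rewrite mxE.
by rewrite -mulr_suml divff// gt_eqF// sum_gibbs_weight_gt0.
Qed.

Lemma jump_rate_ge0 j i q y z : 0 <= jump_rate m j i q y z.
Proof. by rewrite mulr_ge0 ?expR_ge0. Qed.

Lemma jump_rate_le1 j i q y z : jump_rate m j i q y z <= 1.
Proof.
rewrite /jump_rate; case: edge; rewrite ?mulr0// mulr1.
by rewrite -expR0 ler_expR oppr_le0 le_max lexx orbT.
Qed.

Lemma jump_rate_gt0 j i q y z : edge m y z -> 0 < jump_rate m j i q y z.
Proof. by rewrite /jump_rate => ->; rewrite mulr1 expR_gt0. Qed.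

(* Both sides are [exp (- max (V y) (V z))] up to normalization, where [V] is
   the potential. *)
Lemma gibbs_detailed_balance j i q y z : symmetric (edge m) ->
  gibbs m j i q 0 y * jump_rate m j i q y z
  = gibbs m j i q 0 z * jump_rate m j i q z y.
Proof.
move=> edgeC; rewrite !mxE /jump_rate edgeC !mulrA; congr (_ * _).
rewrite [LHS]mulrAC [RHS]mulrAC; congr (_ / _).
rewrite !gibbs_weightE !psiE -!expRD; congr expR.
move: (potential _ _ _ _) (potential _ _ _ _) => a b.
by case: (leP (a - b) 0); case: (leP (b - a) 0); lra.
Qed.

(** The diagonal of the rate matrix supplies the whole outflow from [z], while the term [y = z] of
    the net inflow cancels. *)
Lemma mul_rate_mx j i q (u : 'rV[R]_K) z :
  (u *m rate_mx m j i q) 0 z = net_inflow (jump_rate m j i q) (u 0) z.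
Proof.
rewrite mxE /net_inflow (bigD1 z)//= [RHS](bigD1 z)//= subrr add0r mxE eqxx.
rewrite mulrN mulr_sumr sumrB addrC; congr (_ - _).
by apply: eq_bigr => y yz; rewrite mxE (negbTE yz).
Qed.

(* As [d] has zero mass, the partition function does not contribute. *)
Lemma sum_ln_gibbs j i q (u d : 'I_K -> R) :
  (forall z, 0 < u z) -> \sum_z d z = 0 ->
  \sum_z d z * ln (u z / gibbs m j i q 0 z)
  = \sum_z d z * ln (u z) + \sum_z d z * potential j i q z.
Proof.
move=> u0 d0; pose Z := \sum_y gibbs_weight m j i q y.
transitivity (\sum_z d z * (ln (u z) + potential j i q z + ln Z)).
  apply: eq_bigr => z _; congr (_ * _).
  have Z0 : 0 < Z := sum_gibbs_weight_gt0 _ _ _ z.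
  rewrite ln_div ?posrE ?gibbs_gt0//.
  rewrite mxE ln_div ?posrE ?gibbs_weight_gt0// gibbs_weightE expRK -/Z; lra.
under eq_bigr do rewrite mulrDr mulrDr.
by rewrite !big_split/= -[X in _ + X]mulr_suml d0 mul0r addr0.
Qed.

(** Rewrites the pairing of a velocity [d] with the potential in the bilinear forms that arise on
    differentiating the interaction energy. The kernel appears transposed, since symmetry of [W] is
    only assumed later. *)
Lemma sum_potential j i q (d : 'I_K -> R) :
  \sum_z d z * potential j i q z
  = beta m * (c j central * interaction (fun z x => W m x z) (q j central 0) d
    + match i with
      | central => c j peripheral
          * interaction (fun z x => W m x z) (q j peripheral 0) d
      | peripheral => \sum_l c l peripheral
          * interaction (fun z x => W m x z) (q l peripheral 0) d
      end).
Proof.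
have E (a : R) (u : 'I_K -> R) :
    a * interaction (fun z x => W m x z) u d
    = \sum_z d z * \sum_x W m x z * (a * u x).
  rewrite /interaction mulr_sumr; apply: eq_bigr => z _.
  rewrite !mulr_sumr; apply: eq_bigr => x _; ring.
transitivity (beta m * \sum_z d z * \sum_x W m x z * load j i q x).
  by rewrite mulr_sumr; apply: eq_bigr => z _; rewrite mulrCA.
congr (_ * _); rewrite E.
(* The central load is common to both roles; writing the rest as a difference postpones the case
   distinction on [i]. *)
have -> : \sum_z d z * (\sum_x W m x z * load j i q x)
  = \sum_z d z * (\sum_x W m x z * (c j central * q j central 0 x))
  + \sum_z d z * (\sum_x W m x z *
      (load j i q x - c j central * q j central 0 x)).
  rewrite -big_split/=; apply: eq_bigr => z _; rewrite -mulrDr -big_split/=.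
  by congr (_ * _); apply: eq_bigr => x _; rewrite -mulrDr addrC subrK.
congr (_ + _); case: i.
  rewrite E; apply: eq_bigr => z _; congr (_ * _); apply: eq_bigr => x _.
  by rewrite /load addrAC subrr add0r.
under [RHS]eq_bigr do rewrite E.
rewrite exchange_big/=; apply: eq_bigr => z _.
rewrite -mulr_sumr; congr (_ * _).
rewrite exchange_big/=; apply: eq_bigr => x _; rewrite -mulr_sumr.
by rewrite /load addrAC subrr add0r.
Qed.

Section derivatives.
Variables (q : R -> state R r K) (d : 'I_r -> role -> 'I_K -> R) (t : R).
Hypothesis q_gt0 : forall j i z, 0 < q t j i 0 z.
Hypothesis q_deriv : forall j i z,
  is_derive t 1 (fun s => q s j i 0 z) (d j i z).
Hypothesis d_sum : forall j i, \sum_z d j i z = 0.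

(** At [nu = q t] this is the expression obtained for the free energy below. *)
Lemma is_derive_total_rel_entropy nu :
  is_derive t 1 (fun s => total_rel_entropy m (q s) nu)
    (\sum_j (c j central
         * (\sum_z d j central z
              * ln (q t j central 0 z / gibbs m j central nu 0 z))
       + c j peripheral
         * (\sum_z d j peripheral z
              * ln (q t j peripheral 0 z / gibbs m j peripheral nu 0 z)))).
Proof.
have dR j i := is_derive_rel_entropy (q_gt0 j i) (gibbs_gt0 j i nu)
  (q_deriv j i) (d_sum j i).
have dC := fun a => @is_derive_cstM R a t.
exact: (is_derive_fsum (fun j =>
  is_deriveD (dC _ _ _ (dR j central)) (dC _ _ _ (dR j peripheral)))).
Qed.

(** Symmetry of [W] makes the two halves of each differentiated quadratic term combine, which
    absorbs the factor 1/2. The result is the velocity paired with the potential, to which the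
    entropy adds the logarithm. *)
Lemma is_derive_free_energy C : (forall z z', W m z z' = W m z' z) ->
  is_derive t 1 (fun s => free_energy m C (q s))
    (\sum_j (c j central
         * (\sum_z d j central z
              * ln (q t j central 0 z / gibbs m j central (q t) 0 z))
       + c j peripheral
         * (\sum_z d j peripheral z
              * ln (q t j peripheral 0 z / gibbs m j peripheral (q t) 0 z)))).
Proof.
move=> WC.
pose I := interaction (W m).
have IC u v : I u v = I v u by exact: interactionC.
have dI j i k l : is_derive t 1 (fun s => I (q s j i 0) (q s k l 0))
    (I (d j i) (q t k l 0) + I (q t j i 0) (d k l)).
  exact: (is_derive_interaction _ (q_deriv j i) (q_deriv k l)).
have dE j i := is_derive_entropy (q_gt0 j i) (q_deriv j i) (d_sum j i).
have dC := fun a => @is_derive_cstM R a t.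
have d1 j := dC ((alpha m j * prop m j central) ^+ 2) _ _
  (dI j central j central).
have d2 j := dC (2 * alpha m j ^+ 2 * prop m j peripheral * prop m j central)
  _ _ (dI j peripheral j central).
have d3 j := dC (alpha m j * prop m j peripheral) _ _
  (is_derive_fsum (fun k => dC (alpha m k * prop m k peripheral) _ _
    (dI k peripheral j peripheral))).
have dQ := is_derive_fsum (fun j =>
  dC (beta m / 2) _ _ (is_deriveD (is_deriveD (d1 j) (d2 j)) (d3 j))).
have dS := is_derive_fsum (fun j => is_deriveD
  (dC (alpha m j * prop m j central) _ _ (dE j central))
  (dC (alpha m j * prop m j peripheral) _ _ (dE j peripheral))).
apply: (is_derive_eq (is_deriveD (is_deriveD dQ dS) (is_derive_cst C _ _))).
rewrite addr0.
under [RHS]eq_bigr do rewrite !sum_ln_gibbs// !sum_potential.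
have -> : (fun z x => W m x z) = W m.
  by apply/funext => z; apply/funext => x; exact: WC.
rewrite -/I.
(* The peripheral-peripheral energy couples all blocks and matches only after summation over both
   [j] and [k]. It is set apart as [P]; the remaining terms agree for each [j]. *)
pose P := \sum_j c j peripheral
  * (beta m * \sum_k c k peripheral * I (q t k peripheral 0) (d j peripheral)).
pose S j k := c j peripheral * c k peripheral
  * I (q t k peripheral 0) (d j peripheral).
have PE : P = beta m * \sum_j \sum_k S j k.
  rewrite /P mulr_sumr; apply: eq_bigr => j _; rewrite mulrCA; congr (_ * _).
  by rewrite mulr_sumr; apply: eq_bigr => k _; rewrite mulrA.
have SE : \sum_j c j peripheral * (\sum_k c k peripheral
    * (I (d k peripheral) (q t j peripheral 0)
       + I (q t k peripheral 0) (d j peripheral)))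
    = 2 * \sum_j \sum_k S j k.
  rewrite mulr2n mulrDl !mul1r {1}exchange_big/= -big_split/=.
  apply: eq_bigr => j _; rewrite mulr_sumr -big_split/=; apply: eq_bigr => k _.
  rewrite /S [I (d k _) _]IC; ring.
have {}SE : beta m / 2 * (\sum_j c j peripheral * (\sum_k c k peripheral
    * (I (d k peripheral) (q t j peripheral 0)
       + I (q t k peripheral 0) (d j peripheral)))) = P.
  by rewrite SE PE; field.
transitivity (\sum_j (beta m / 2 *
   ((alpha m j * prop m j central) ^+ 2
      * (I (d j central) (q t j central 0) + I (q t j central 0) (d j central))
    + 2 * alpha m j ^+ 2 * prop m j peripheral * prop m j central
      * (I (d j peripheral) (q t j central 0)
         + I (q t j peripheral 0) (d j central)))
   + (c j central * (\sum_z d j central z * ln (q t j central 0 z))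
   + c j peripheral
       * (\sum_z d j peripheral z * ln (q t j peripheral 0 z)))) + P).
  rewrite -SE mulr_sumr -!big_split/=; apply: eq_bigr => j _; rewrite /c; ring.
rewrite /P -big_split/=; apply: eq_bigr => j _.
rewrite [I (d j central) _]IC [I (d j peripheral) (q t j central 0)]IC /c.
by field.
Qed.

End derivatives.

End model.

(** * Positivity along the nonlinear flow, and the theorem *)

Lemma McKean_Vlasov_gt0 (R : realType) (r K : nat) (m : params R r K)
    (mu : R -> state R r K) (t : R) j i z :
  (forall y z, connect (edge m) y z) -> McKean_Vlasov_solution m mu -> 0 < t ->
  0 < mu t j i 0 z /\ \sum_y mu t j i 0 y = 1.
Proof.
move=> conn mu_sol t0; have [[mu0_ge0 mu0_sum] mu_cvg0 mu_deriv] := mu_sol j i.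
(* Evaluating the rates along the given solution turns the nonlinear equation into a linear one with
   time-dependent coefficients. *)
pose u s z := mu s j i 0 z; pose lam s := jump_rate m j i (mu s).
have u_cvg0 y : u s y @[s --> (0 : R)^'+] --> u 0 y.
  exact: (continuous_cvg _ (@coord_continuous _ _ _ 0 y _) mu_cvg0).
have u_deriv (s : R) y : 0 < s ->
    is_derive s 1 (fun s => u s y) (net_inflow (lam s) (u s) y).
  by move=> s0; rewrite -mul_rate_mx; exact/is_derive_coord/mu_deriv.
have lam_ge0 s y x : 0 <= lam s y x by exact: jump_rate_ge0.
have u_ge0 s y : 0 <= s -> 0 <= u s y.
  apply: (@master_ge0 _ _ u lam u_cvg0 u_deriv lam_ge0 1) => // *.
  exact: jump_rate_le1.
have u_mass s : 0 <= s -> \sum_y u s y = 1.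
  by move=> s0; rewrite (master_mass u_cvg0 u_deriv s0).
split; last exact/u_mass/ltW.
apply: (@master_gt0 _ _ u lam u_cvg0 u_deriv lam_ge0 (edge m)) => //.
  by rewrite u_mass.
by move=> s y x; exact: jump_rate_gt0.
Qed.

Theorem proposition3p4 (R : realType) (r K : nat) (m : params R r K)
    (r_gt0 : (0 < r)%N)
    (alpha01 : forall j, 0 < alpha m j < 1)
    (prop01 : forall j i, 0 < prop m j i < 1)
    (prop_sum : forall j, prop m j central + prop m j peripheral = 1)
    (alpha_sum : \sum_j alpha m j = 1)
    (beta_gt0 : 0 < beta m)
    (W_sym : forall z z', W m z z' = W m z' z)
    (edge_irr : irreflexive (edge m))
    (edge_sym : symmetric (edge m))
    (edge_connected : forall z z', connect (edge m) z z')
    (C : R) (mu : R -> state R r K)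
    (mu_sol : McKean_Vlasov_solution m mu)
    (t : R) (t_gt0 : 0 < t) :
  let dF := ((fun s => free_energy m C (mu s))^`() t)%classic in
  let dH := fun nu : state R r K =>
    ((fun s => total_rel_entropy m (mu s) nu)^`() t)%classic in
  [/\ derivable (fun s => free_energy m C (mu s)) t 1,
      derivable (fun s => total_rel_entropy m (mu s) (mu t)) t 1,
      dF = dH (mu t),
      dH (mu t) <= 0 &
      dF = 0 <-> (forall j i, mu t j i = gibbs m j i (mu t))].
Proof.
have mu_gt0 j i z : 0 < mu t j i 0 z.
  by have [] := McKean_Vlasov_gt0 j i z edge_connected mu_sol t_gt0.
(* An initial vector of mass 1 cannot be indexed by the empty set; the facts about total mass take
   such a site as argument. *)
have site (j : 'I_r) : 'I_K.
  have [[_ s1] _ _] := mu_sol j central.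
  case: (pickP (@predT 'I_K)) => [z //|K0]; exfalso.
  by move: s1; rewrite big_pred0// => /esym/eqP; rewrite oner_eq0.
have mu_sum j i : \sum_z mu t j i 0 z = 1.
  by have [] := McKean_Vlasov_gt0 j i (site j) edge_connected mu_sol t_gt0.
pose d j i z := net_inflow (jump_rate m j i (mu t)) (mu t j i 0) z.
have mu_deriv j i z : is_derive t 1 (fun s => mu s j i 0 z) (d j i z).
  rewrite /d -mul_rate_mx; apply: is_derive_coord.
  by have [_ _] := mu_sol j i; apply.
have d_sum j i : \sum_z d j i z = 0 by exact: sum_net_inflow.
pose D j i := \sum_z d j i z * ln (mu t j i 0 z / gibbs m j i (mu t) 0 z).
have [derF dF_E] := is_derive_free_energy mu_gt0 mu_deriv d_sum C W_sym.
have [derH dH_E] := is_derive_total_rel_entropy m mu_gt0 mu_deriv d_sum (mu t).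
(* Both derivatives are now the same explicit sum, so their equality is immediate. *)
rewrite /= !derive1E dF_E dH_E.
have c_gt0 j i : 0 < alpha m j * prop m j i.
  have /andP[? _] := alpha01 j; have /andP[? _] := prop01 j i.
  exact: mulr_gt0.
have balance j i y z := gibbs_detailed_balance j i (mu t) y z edge_sym.
have D_le0 j i : D j i <= 0.
  apply: entropy_production_le0 => // *; first exact: jump_rate_ge0.
  exact: gibbs_gt0.
have term_le0 j : alpha m j * prop m j central * D j central
    + alpha m j * prop m j peripheral * D j peripheral <= 0.
  by rewrite -[leRHS]addr0 lerD// pmulr_rle0.
have D_eq0 j i : D j i = 0 <-> mu t j i = gibbs m j i (mu t).
  have [D0 D1] : D j i = 0 <-> mu t j i 0 =1 gibbs m j i (mu t) 0.
    apply: (@entropy_production_eq0 _ _ _ _ _ _ _ _ _ (edge m)) => //.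
    - by move=> *; exact: jump_rate_ge0.
    - by move=> *; exact: gibbs_gt0.
    - by move=> *; exact: jump_rate_gt0.
    - exact: sum_gibbs (site j).
  by split=> [/D0 E|E]; [apply/rowP|apply: D1; rewrite E].
split=> //.
  by apply: sumr_le0 => j _; exact: term_le0.
split=> [/eqP|E]; last first.
  by apply: big1 => j _; rewrite -!/(D _ _) !(D_eq0 _ _).2// !mulr0 addr0.
(* A vanishing sum of nonpositive terms has all its terms zero, first over [j] and then over the two
   roles; the positive weights cancel. *)
rewrite -oppr_eq0 -sumrN psumr_eq0 => [/allP H j i|j _]; last first.
  by rewrite oppr_ge0 term_le0.
apply/D_eq0/eqP; have := H j (mem_index_enum _).
have cD_le0 k : alpha m j * prop m j k * D j k <= 0 by rewrite pmulr_rle0.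
rewrite /= oppr_eq0 -!/(D _ _) naddr_eq0 ?cD_le0// !mulrI_eq0.
- by case: i => /andP[].
- by apply/lregP; rewrite gt_eqF.
- by apply/lregP; rewrite gt_eqF.
Qed.
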